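(* Let $A$ and $B$ be non-trivial recursively presented groups and let $H\le B$. If the membership problem is not solvable for $H$ in $B$, then the conjugacy problem is not solvable in the permutational restricted wreath product $A\wr_{B/H}B$.
   Context: A group is recursively presented if it has a presentation with finitely many generators and a recursively enumerable set of relators. Elements are given as words in the generators. The conjugacy problem is solvable if an algorithm decides, for any two words in the generators, whether they represent conjugate elements. The membership problem for $H$ is solvable if an algorithm decides, for any $w\in B$ given as a word, whether $w\in H$. $S=B/H$ is the set of right cosets of $H$ with $B$ acting transitively by right multiplication, and $s_0=H$. The permutational restricted wreath product is $A\wr_S B=\{(b,f): b\in B,\ f\in A^{(S)}\}$, where $A^{(S)}$ is the group (pointwise multiplication) of functions $f:S\to A$ with finite support, $f^{c}(s)=f(sc^{-1})$, and $(b,f)(c,g)=(bc,f^{c}g)$. It is generated by the elements $(b,1)$ with $b$ a generator of $B$ and $(1_B,a^{(s_0)})$ with $a$ a generator of $A$, where $a^{(s)}$ takes the value $a$ at $s$ and $1_A$ elsewhere. *)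

(* Defs.v *)
From HB Require Import structures.
From mathcomp Require Import all_boot finmap.
From mathcomp Require Import boolp classical_sets.

Set Implicit Arguments.
Unset Strict Implicit.
Unset Printing Implicit Defensive.

Local Open Scope classical_set_scope.

(* Kleene's partial recursive functions; an n-ary partial function nat^n -> nat
   is represented by its graph. *)
Inductive partial_recursive : forall n, (n.-tuple nat -> nat -> Prop) -> Prop :=
| PR_zero : @partial_recursive 0 (fun _ y => y = 0)
| PR_succ : @partial_recursive 1 (fun v y => y = (thead v).+1)
| PR_proj n (i : 'I_n) : @partial_recursive n (fun v y => y = tnth v i)
| PR_comp m n (F : m.-tuple nat -> nat -> Prop)
    (G : 'I_m -> n.-tuple nat -> nat -> Prop) :
    partial_recursive F -> (forall i, partial_recursive (G i)) ->
    @partial_recursive n (fun v y =>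
      exists w : m.-tuple nat, (forall i, G i v (tnth w i)) /\ F w y)
(* s lists the successive values h(0, t), h(1, t), ... of the function h with
   h(0, t) = F(t) and h(i+1, t) = G(i, h(i, t), t), and v = (x, t) *)
| PR_primrec n (F : n.-tuple nat -> nat -> Prop)
    (G : n.+2.-tuple nat -> nat -> Prop) :
    partial_recursive F -> partial_recursive G ->
    @partial_recursive n.+1 (fun v y =>
      exists s : nat -> nat,
        [/\ F [tuple of behead v] (s 0),
            forall i, i < thead v -> G [tuple of [:: i, s i & behead v]] (s i.+1)
          & y = s (thead v)])
| PR_mu n (F : n.+1.-tuple nat -> nat -> Prop) :
    partial_recursive F ->
    @partial_recursive n (fun v y =>
      F [tuple of y :: v] 0 /\
      forall z, z < y -> exists t, F [tuple of z :: v] t.+1).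

Lemma partial_recursive_functional n (F : n.-tuple nat -> nat -> Prop) :
  partial_recursive F -> forall v y y', F v y -> F v y' -> y = y'.
Proof.
elim=> {n F}.
- by move=> v y y' -> ->.
- by move=> v y y' -> ->.
- by move=> n i v y y' -> ->.
- move=> m n F G _ IHF _ IHG v y y' [w [Gw Fw]] [w' [Gw' Fw']].
  suff E : w = w' by apply: IHF Fw _; rewrite E.
  by apply: eq_from_tnth => i; apply: IHG (Gw i) (Gw' i).
- move=> n F G _ IHF _ IHG v y y' [s [s0 sS ->]] [s' [s'0 s'S ->]].
  suff E i : i <= thead v -> s i = s' i by apply: E.
  elim: i => [|i IHi] lti; first exact: IHF s0 s'0.
  apply: IHG (sS i lti) _; rewrite (IHi (ltnW lti)); exact: s'S.
- move=> n F _ IHF v y y' [Fy lty] [Fy' lty'].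
  case: (ltngtP y y') => // lt.
  + by have [t Ft] := lty' _ lt; have := IHF _ _ _ Fy Ft.
  + by have [t Ft] := lty _ lt; have := IHF _ _ _ Fy' Ft.
Qed.

(* Group words on n generators: the letter (i, false) is the i-th generator and
   (i, true) is its inverse. *)
Definition letter n : Type := 'I_n * bool.
Definition word n : Type := seq (letter n).

Definition letter_inv n (x : letter n) : letter n := (x.1, ~~ x.2).

Definition letter_code n (x : letter n) : nat := x.1.*2 + x.2.

(* Bijective base-2n numeration, with digits letter_code x + 1 in {1, .., 2n}
   and the first letter least significant. *)
Fixpoint word_code n (w : word n) : nat :=
  if w is x :: w' then (letter_code x).+1 + n.*2 * word_code w' else 0.

Lemma word_code_inj n : injective (@word_code n).
Proof.
have lt_code (x : letter n) : letter_code x < n.*2.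
  rewrite /letter_code; apply: leq_trans (_ : x.1.+1.*2 <= _).
    by rewrite doubleS; case: x.2; rewrite ?addn1 ?addn0.
  by rewrite leq_double.
elim=> [|x u IHu] [|y v] //= /eqP; rewrite !addSn eqSS => /eqP E.
have n0 : 0 < n.*2 by apply: leq_ltn_trans (lt_code x).
have Exy : letter_code x = letter_code y.
  have := congr1 (modn^~ n.*2) E.
  by rewrite !(addnC (letter_code _)) ![n.*2 * _]mulnC !modnMDl !modn_small.
have Euv : u = v.
  apply: IHu; move/eqP: E; rewrite Exy eqn_add2l eqn_pmul2l //.
  by move/eqP.
rewrite Euv; congr cons; move: Exy.
case: x y {E} => [i a] [j b]; rewrite /letter_code /= => Eij.
have Eab : a = b.
  by have := congr1 odd Eij; rewrite !oddD !odd_double /= !oddb.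
rewrite Eab in Eij *; congr pair; apply: val_inj => /=.
by move/eqP: Eij; rewrite eqn_add2r -!muln2 eqn_pmul2r // => /eqP.
Qed.

(* R is the domain of a partial recursive function. *)
Definition recursively_enumerable n (R : set (word n)) : Prop :=
  exists F : 1.-tuple nat -> nat -> Prop,
    partial_recursive F /\
    forall w : word n, R w <-> exists y, F [tuple word_code w] y.

(* A decision problem on q-tuples of words is solvable when some recursive
   function outputs 1 on the positive instances and 0 on the negative ones. *)
Definition solvable_problem n q (P : set (q.-tuple (word n))) : Prop :=
  exists F : q.-tuple nat -> nat -> Prop,
    partial_recursive F /\
    forall ws : q.-tuple (word n),
      (P ws -> F [tuple of map (@word_code n) ws] 1) /\
      (~ P ws -> F [tuple of map (@word_code n) ws] 0).

(* The congruence on words whose classes form the group < X | R >. *)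
Inductive relators_eq n (R : set (word n)) : word n -> word n -> Prop :=
| RE_refl u : relators_eq R u u
| RE_sym u v : relators_eq R u v -> relators_eq R v u
| RE_trans u v w : relators_eq R u v -> relators_eq R v w -> relators_eq R u w
| RE_cancel u x v : relators_eq R (u ++ [:: x; letter_inv x] ++ v) (u ++ v)
| RE_relator u r v : R r -> relators_eq R (u ++ r ++ v) (u ++ v).

Local Open Scope group_scope.

Definition word_eval (G : groupType) n (g : 'I_n -> G) (w : word n) : G :=
  \prod_(x <- w) (if x.2 then (g x.1)^-1 else g x.1).

Definition presentation (G : groupType) n (g : 'I_n -> G) (R : set (word n)) :
    Prop :=
  (forall x : G, exists w, word_eval g w = x) /\
  (forall u v, word_eval g u = word_eval g v <-> relators_eq R u v).

Definition recursive_presentation (G : groupType) n (g : 'I_n -> G)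
    (R : set (word n)) : Prop :=
  presentation g R /\ recursively_enumerable R.

Definition membership_solvable (G : groupType) n (g : 'I_n -> G) (H : set G) :
    Prop :=
  solvable_problem (fun ws : 1.-tuple (word n) =>
    H (word_eval g (thead ws))).

Definition conjugate (G : groupType) (x y : G) : Prop :=
  exists z : G, y = x ^ z.

Definition conjugacy_solvable (G : groupType) n (g : 'I_n -> G) : Prop :=
  solvable_problem (fun ws : 2.-tuple (word n) =>
    conjugate (word_eval g (tnth ws ord0)) (word_eval g (tnth ws ord_max))).

(* B/H as the type of the subsets Hb of B; the group structure built below on
   the wreath product makes sense for any subset H, subgroup or not. *)
Record rcosets (B : groupType) (H : set B) : Type := RCoset {
  rcoset_set : set B;
  rcoset_setP : exists b : B, rcoset_set = [set h * b | h in H] }.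

Lemma rcoset_ext (B : groupType) (H : set B) (s t : rcosets H) :
  rcoset_set s = rcoset_set t -> s = t.
Proof.
case: s t => [X pX] [Y pY] /= E; rewrite E in pX *.
by congr RCoset; apply: Prop_irrelevance.
Qed.

HB.instance Definition _ (B : groupType) (H : set B) :=
  gen_eqMixin (rcosets H).
HB.instance Definition _ (B : groupType) (H : set B) :=
  gen_choiceMixin (rcosets H).

Section CosetAction.
Variables (B : groupType) (H : set B).
Implicit Type s : rcosets H.

Fact rcoset0_subproof : exists b : B, H = [set h * b | h in H].
Proof.
exists 1; apply/seteqP; split=> [x Hx|_ [x Hx <-]]; last by rewrite mulg1.
by exists x; rewrite ?mulg1.
Qed.

(* the base point s_0 = H *)
Definition rcoset0 : rcosets H := RCoset rcoset0_subproof.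

Fact rcoset_act_subproof s c :
  exists b : B, [set x * c | x in rcoset_set s] = [set h * b | h in H].
Proof.
case: (rcoset_setP s) => b Es; exists (b * c); rewrite Es; apply/seteqP; split.
  by move=> _ [_ [h Hh <-] <-]; exists h; rewrite ?mulgA.
by move=> _ [h Hh <-]; exists (h * b); rewrite ?mulgA //; exists h.
Qed.

Definition rcoset_act s c : rcosets H := RCoset (rcoset_act_subproof s c).

Lemma rcoset_act1 s : rcoset_act s 1 = s.
Proof.
apply: rcoset_ext => /=; apply/seteqP; split=> [_ [x sx <-]|x sx].
  by rewrite mulg1.
by exists x; rewrite ?mulg1.
Qed.

Lemma rcoset_actM s c d : rcoset_act s (c * d) = rcoset_act (rcoset_act s c) d.
Proof.
apply: rcoset_ext => /=; apply/seteqP; split.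
  by move=> _ [x sx <-]; exists (x * c); rewrite ?mulgA //; exists x.
by move=> _ [_ [x sx <-] <-]; exists x; rewrite ?mulgA.
Qed.

Lemma rcoset_actK s c : rcoset_act (rcoset_act s c) c^-1 = s.
Proof. by rewrite -rcoset_actM mulgV rcoset_act1. Qed.

Lemma rcoset_actKV s c : rcoset_act (rcoset_act s c^-1) c = s.
Proof. by rewrite -rcoset_actM mulVg rcoset_act1. Qed.

End CosetAction.

Section FinitelySupported.
Variables (A B : groupType) (H : set B).

(* A^(S) with S = B/H *)
Definition base_fun := {fsfun rcosets H -> A with 1}.
Implicit Types f g : base_fun.

Definition base_one : base_fun := [fsfun of _ => 1].

Definition base_mul f g : base_fun :=
  [fsfun s in (finsupp f `|` finsupp g)%fset => f s * g s | 1].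

Definition base_inv f : base_fun :=
  [fsfun s in finsupp f => (f s)^-1 | 1].

(* f^c *)
Definition base_act f (c : B) : base_fun :=
  [fsfun s in [fset rcoset_act t c | t in finsupp f]%fset =>
     f (rcoset_act s c^-1) | 1].

(* a^(s) *)
Definition base_single (a : A) (s : rcosets H) : base_fun :=
  [fsfun t in [fset s]%fset => a | 1].

Lemma base_oneE s : base_one s = 1.
Proof. exact: fsfun0E. Qed.

Lemma base_mulE f g s : base_mul f g s = f s * g s.
Proof.
rewrite fsfunE in_fsetU; case: (finsuppP f s) => //= sf.
by case: (finsuppP g s) => //= sg; rewrite mulg1.
Qed.

Lemma base_invE f s : base_inv f s = (f s)^-1.
Proof. by rewrite fsfunE; case: (finsuppP f s) => //=; rewrite invg1. Qed.

Lemma base_actE f c s : base_act f c s = f (rcoset_act s c^-1).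
Proof.
rewrite fsfunE; case: ifPn => // /negP nfs.
rewrite [RHS]fsfun_dflt //; apply/negP => fs; apply: nfs.
by apply/imfsetP; exists (rcoset_act s c^-1) => //=; rewrite rcoset_actKV.
Qed.

Lemma base_singleE a s t : base_single a s t = if t == s then a else 1.
Proof. by rewrite fsfunE in_fset1. Qed.

End FinitelySupported.

Arguments base_one {A B H}.

(* The permutational restricted wreath product of A and B over S = B/H;
   Wreath b f is the pair (b, f). *)
Record wreath (A B : groupType) (H : set B) : Type := Wreath {
  wr_top : B;
  wr_base : base_fun A H }.

HB.instance Definition _ (A B : groupType) (H : set B) :=
  gen_eqMixin (wreath A H).
HB.instance Definition _ (A B : groupType) (H : set B) :=
  gen_choiceMixin (wreath A H).

Section WreathGroup.
Variables (A B : groupType) (H : set B).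
Implicit Types x y z : wreath A H.

Definition wr_one : wreath A H := Wreath 1 base_one.

Definition wr_mul x y : wreath A H :=
  Wreath (wr_top x * wr_top y)
         (base_mul (base_act (wr_base x) (wr_top y)) (wr_base y)).

Definition wr_inv x : wreath A H :=
  Wreath (wr_top x)^-1 (base_act (base_inv (wr_base x)) (wr_top x)^-1).

Lemma wreath_ext x y :
  wr_top x = wr_top y -> wr_base x =1 wr_base y -> x = y.
Proof. by case: x y => [b f] [c g] /= -> /fsfunP ->. Qed.

Fact wr_mulA : associative wr_mul.
Proof.
move=> x y z; apply: wreath_ext => [|s] /=; first by rewrite mulgA.
by rewrite !(base_mulE, base_actE) invgM rcoset_actM mulgA.
Qed.

Fact wr_mul1 : left_id wr_one wr_mul.
Proof.
move=> x; apply: wreath_ext => [|s] /=; first by rewrite mul1g.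
by rewrite base_mulE base_actE base_oneE mul1g.
Qed.

Fact wr_mulr1 : right_id wr_one wr_mul.
Proof.
move=> x; apply: wreath_ext => [|s] /=; first by rewrite mulg1.
by rewrite base_mulE base_actE base_oneE mulg1 invg1 rcoset_act1.
Qed.

Fact wr_mulV : left_inverse wr_one wr_inv wr_mul.
Proof.
move=> x; apply: wreath_ext => [|s] /=; first by rewrite mulVg.
by rewrite base_mulE !base_actE base_oneE base_invE rcoset_actK mulVg.
Qed.

Fact wr_mulrV : right_inverse wr_one wr_inv wr_mul.
Proof.
move=> x; apply: wreath_ext => [|s] /=; first by rewrite mulgV.
by rewrite base_mulE !base_actE base_oneE base_invE mulgV.
Qed.

HB.instance Definition _ :=
  isGroup.Build (wreath A H) wr_mulA wr_mul1 wr_mulr1 wr_mulV wr_mulrV.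

End WreathGroup.

(* The generators (b, 1) for b in gB, followed by the generators
   (1, a^(s_0)) for a in gA. *)
Definition wreath_gens (A B : groupType) m n (gA : 'I_m -> A) (gB : 'I_n -> B)
    (H : set B) (i : 'I_(n + m)) : wreath A H :=
  match split i with
  | inl j => Wreath (gB j) base_one
  | inr k => Wreath 1 (base_single (gA k) (rcoset0 H))
  end.
Arguments wreath_gens {A B m n} gA gB H i.

(* Main.v *)
Require Import Defs.
From HB Require Import structures.
From mathcomp Require Import all_boot finmap.
From mathcomp Require Import boolp classical_sets.

Set Implicit Arguments.
Unset Strict Implicit.
Unset Printing Implicit Defensive.

(** Fix a generator [a <> 1] of [A]. In the wreath product, [a^(s_0)] conjugated
    by [b] is [a^(s_0 b)], so the commutator of [b] and [a^(s_0)] is trivial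
    exactly when [s_0 b = s_0], that is when [b] lies in [H]. As only the
    identity is conjugate to the identity, [w |-> (w^-1 a^-1 w a, empty word)]
    reduces membership in [H] to conjugacy; this map is recursive on codes. *)

(** * Total recursive functions *)

Local Notation "s `_ i" := (nth 0 s i).

Definition recursive n (f : n.-tuple nat -> nat) : Prop :=
  partial_recursive (fun v y => y = f v).

Definition recursive1 (f : nat -> nat) : Prop :=
  recursive (fun v : 1.-tuple nat => f v`_0).

Definition recursive2 (f : nat -> nat -> nat) : Prop :=
  recursive (fun v : 2.-tuple nat => f v`_0 v`_1).

Lemma recursive_ext n (f g : n.-tuple nat -> nat) :
  f =1 g -> recursive f -> recursive g.
Proof. by move=> /funext ->. Qed.

Lemma recursive1_ext (f g : nat -> nat) :
  f =1 g -> recursive1 f -> recursive1 g.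
Proof. by move=> /funext ->. Qed.

Lemma recursive_comp m n (f : m.-tuple nat -> nat)
    (g : 'I_m -> n.-tuple nat -> nat) :
  recursive f -> (forall i, recursive (g i)) ->
  recursive (fun v => f [tuple g i v | i < m]).
Proof.
move=> rf rg; rewrite /recursive; set F := (X in partial_recursive X).
suff -> : F = fun v y => exists w : m.-tuple nat,
    (forall i, tnth w i = g i v) /\ y = f w by exact: (PR_comp rf rg).
apply/funext => v; apply/funext => y; apply/propext; split=> [-> | [w [gw ->]]].
  by exists [tuple g i v | i < m]; split=> // i; rewrite tnth_mktuple.
by congr f; apply: eq_from_tnth => i; rewrite tnth_mktuple.
Qed.

Lemma recursive_nth n i : i < n -> recursive (fun v : n.-tuple nat => v`_i).
Proof.
move=> lti; have rp : recursive (fun v => tnth v (Ordinal lti)) := PR_proj _.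
by apply: recursive_ext rp => v; rewrite (tnth_nth 0).
Qed.

Arguments recursive_nth : clear implicits.

Lemma recursive_app1 f n (g : n.-tuple nat -> nat) :
  recursive1 f -> recursive g -> recursive (fun v => f (g v)).
Proof.
move=> rf rg; apply: recursive_ext (recursive_comp rf (fun=> rg)) => v.
by rewrite (nth_mktuple _ 0 ord0).
Qed.

Lemma recursive_app2 f n (g h : n.-tuple nat -> nat) :
  recursive2 f -> recursive g -> recursive h ->
  recursive (fun v => f (g v) (h v)).
Proof.
move=> rf rg rh.
pose k (i : 'I_2) := if i == 0 :> nat then g else h.
have rk i : recursive (k i) by rewrite /k; case: ifP.
apply: recursive_ext (recursive_comp rf rk) => v.
by rewrite (nth_mktuple _ 0 ord0) (nth_mktuple _ 0 ord_max).
Qed.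

(** [PR_primrec] takes the number of rounds as its first argument, so the iteration is built on
    [n.+1] arguments and composed with [(k v, v)]. The step receives the index, the accumulator,
    then [v]; this order fixes the positions passed to [recursive_nth] below. *)
Lemma recursive_iteri n (k f : n.-tuple nat -> nat)
    (g : n.+2.-tuple nat -> nat) :
  recursive k -> recursive f -> recursive g ->
  recursive (fun v =>
    iteri (k v) (fun i s => g [tuple of [:: i, s & v]]) (f v)).
Proof.
move=> rk rf rg.
pose h (v : n.+1.-tuple nat) :=
  iteri (thead v) (fun i s => g [tuple of [:: i, s & behead v]])
    (f [tuple of behead v]).
have rh : recursive h.
  rewrite /recursive; set F := (X in partial_recursive X).
  suff -> : F = fun v y => exists s : nat -> nat,
      [/\ s 0 = f [tuple of behead v],
          forall i, i < thead v ->
            s i.+1 = g [tuple of [:: i, s i & behead v]]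
        & y = s (thead v)] by exact: (PR_primrec rf rg).
  apply/funext => v; apply/funext => y; apply/propext.
  split=> [-> | [s [s0 sS ->]]].
    by exists (fun j => iteri j
      (fun i s => g [tuple of [:: i, s & behead v]]) (f [tuple of behead v])).
  suff E i : i <= thead v -> s i =
      iteri i (fun i s => g [tuple of [:: i, s & behead v]])
        (f [tuple of behead v]) by exact: E.
  by elim: i => [|i IHi] lti //=; rewrite sS // IHi // ltnW.
pose p (i : 'I_n.+1) (v : n.-tuple nat) := (k v :: v)`_i.
have rp i : recursive (p i).
  rewrite /p; case: i => -[|i] //= lti; exact: recursive_nth.
apply: recursive_ext (recursive_comp rh rp) => v.
have -> : [tuple p i v | i < n.+1] = [tuple of k v :: v].
  by apply: eq_from_tnth => i; rewrite tnth_mktuple (tnth_nth 0).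
rewrite /h theadE; have -> : [tuple of behead [tuple of k v :: v]] = v.
  exact: val_inj.
congr (iteri _ _ _).
by apply/funext => i; apply/funext => s; congr g; apply: val_inj.
Qed.

Lemma recursive1_succ : recursive1 succn.
Proof.
have rs : recursive (fun v : 1.-tuple nat => (thead v).+1) := PR_succ.
by apply: recursive_ext rs => v; rewrite /thead (tnth_nth 0).
Qed.

Lemma recursive_const n k : recursive (fun _ : n.-tuple nat => k).
Proof.
elim: k => [|k IHk]; last exact: recursive_app1 recursive1_succ IHk.
have rp (i : 'I_0) : recursive (fun v : n.-tuple nat => i) by case: i.
exact: (@recursive_comp 0 n (fun=> 0) _ PR_zero rp).
Qed.

Lemma recursive2_addn : recursive2 addn.
Proof.
apply: recursive_ext (recursive_iteri
  (recursive_nth 2 0 isT) (recursive_nth 2 1 isT)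
  (recursive_app1 recursive1_succ (recursive_nth 4 1 isT))) => v /=.
by elim: (_`_0) => //= i ->.
Qed.

Lemma recursive1_muln q : recursive1 (muln q).
Proof.
elim: q => [|q IHq]; first exact: (recursive_const 1 0).
exact: recursive_app2 recursive2_addn (recursive_nth 1 0 isT) IHq.
Qed.

(** A case analysis is an iteration whose step ignores the accumulator: only the last round counts,
    and its index is the predecessor. *)
Lemma recursive1_case (a : nat) (g : nat -> nat) :
  recursive1 g -> recursive1 (fun x => if x is y.+1 then g y else a).
Proof.
move=> rg; have rgn := recursive_app1 rg (recursive_nth 3 0 isT).
apply: recursive_ext (recursive_iteri
  (recursive_nth 1 0 isT) (recursive_const 1 a) rgn) => v /=.
by case: (_`_0).
Qed.

(** Finite tables are recursive whatever [g] is: each case analysis peels off the value at [0] and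
    shifts the rest. *)
Lemma recursive1_finite k (g : nat -> nat) :
  recursive1 (fun x => if x < k then g x else 0).
Proof.
elim: k g => [|k IHk] g; first exact: (recursive_const 1 0).
apply: recursive1_ext (recursive1_case (g 0) (IHk (fun x => g x.+1))).
by case.
Qed.

(** The remainder is a cyclic counter: its step is [succn] below [q.-1] and [0] from there on, hence
    a finite table. *)
Lemma recursive1_modn q : 0 < q -> recursive1 (modn^~ q).
Proof.
move=> q0; apply: recursive_ext (recursive_iteri
  (recursive_nth 1 0 isT) (recursive_const 1 0)
  (recursive_app1 (recursive1_finite q.-1 succn)
    (recursive_nth 3 1 isT))) => v /=.
elim: (_`_0) => [|i /= ->] /=; first by rewrite mod0n.
rewrite -(addn1 i) -(modnDml i) addn1.
have : i %% q < q.-1.+1 by rewrite prednK // ltn_pmod.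
rewrite ltnS leq_eqVlt.
case: ltnP => [lt _ | _ /orP[/eqP -> |]//].
  by rewrite [RHS]modn_small // -ltn_predRL.
by rewrite prednK // modnn.
Qed.

Lemma divnS i q : 0 < q -> i.+1 %/ q = i %/ q + (i %% q == q.-1).
Proof.
move=> q0; rewrite {1}(divn_eq i q) -addnS divnMDl //; congr addn.
have : i %% q < q.-1.+1 by rewrite prednK // ltn_pmod.
rewrite ltnS leq_eqVlt.
case: eqP => [-> _ | _ /= lt]; first by rewrite prednK // divnn q0.
by rewrite divn_small // -ltn_predRL.
Qed.

(** By [divnS] the quotient grows exactly when the remainder is [q.-1], a test given by a finite
    table. *)
Lemma recursive1_divn q : 0 < q -> recursive1 (divn^~ q).
Proof.
move=> q0; have rm := recursive_app1 (recursive1_modn q0)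
  (recursive_nth 3 0 isT).
apply: recursive_ext (recursive_iteri
  (recursive_nth 1 0 isT) (recursive_const 1 0)
  (recursive_app2 recursive2_addn (recursive_nth 3 1 isT)
  (recursive_app1 (recursive1_finite q (fun r => r == q.-1))
    rm))) => v /=.
elim: (_`_0) => [|i /= ->] /=; first by rewrite div0n.
by rewrite ltn_pmod // divnS.
Qed.

(** * Inversion of words on codes *)

(** Digits range over 1 to [n.*2], hence the predecessor before the division. Code [0], the empty
    word, is a fixed point. *)
Definition code_behead n c := c.-1 %/ n.*2.

(** The parity of a letter code records the exponent, so inversion exchanges [2i] and [2i+1]. *)
Definition digit_inv d := if odd d then d.-1 else d.+1.

(* [t] with the inverse of the first letter of the word coded by [r] prepended,
   where [r] is over [n] generators and [t] over [N] generators. *)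
Definition code_cons_inv n N r t :=
  if r is c.+1 then (digit_inv (c %% n.*2)).+1 + N.*2 * t else t.

(* A word has at most as many letters as its code, and steps beyond
   the last letter do nothing. *)
Definition code_cat_inv n N c t :=
  iteri c (fun i => code_cons_inv n N (iter i (code_behead n) c)) t.

Lemma recursive2_iter_code_behead n : 0 < n ->
  recursive2 (fun i => iter i (code_behead n)).
Proof.
rewrite -double_gt0 => n0; have rp : recursive1 predn.
  apply: recursive1_ext (recursive1_case 0 (recursive_nth 1 0 isT)).
  by case.
have rb : recursive1 (code_behead n).
  exact: recursive_app1 (recursive1_divn n0) rp.
apply: recursive_ext (recursive_iteri
  (recursive_nth 2 0 isT) (recursive_nth 2 1 isT)
  (recursive_app1 rb (recursive_nth 4 1 isT))) => v /=.
by elim: (_`_0) => //= i ->.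
Qed.

Lemma recursive2_code_cons_inv n N : 0 < n -> recursive2 (code_cons_inv n N).
Proof.
rewrite -double_gt0 => n0.
have rd := recursive_app1 (recursive1_modn n0) (recursive_nth 4 0 isT).
(* The remainder is below [n.*2], so a finite table suffices for [digit_inv]. *)
have rg := recursive_app1
  (recursive1_finite n.*2 (fun d => (digit_inv d).+1)) rd.
have rt := recursive_app1 (recursive1_muln N.*2) (recursive_nth 4 3 isT).
apply: recursive_ext (recursive_iteri
  (recursive_nth 2 0 isT) (recursive_nth 2 1 isT)
  (recursive_app2 recursive2_addn rg rt)) => v /=.
by case: (_`_0) => //= c; rewrite ltn_pmod.
Qed.

Lemma recursive1_code_cat_inv n N (f g : nat -> nat) : 0 < n ->
  recursive1 f -> recursive1 g ->
  recursive1 (fun c => code_cat_inv n N (f c) (g c)).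
Proof.
move=> n0 rf rg.
have ri := recursive_app2 (recursive2_iter_code_behead n0)
  (recursive_nth 3 0 isT)
  (recursive_app1 rf (recursive_nth 3 2 isT)).
exact: recursive_ext (recursive_iteri rf rg
  (recursive_app2 (recursive2_code_cons_inv N n0) ri
    (recursive_nth 3 1 isT))).
Qed.

Definition word_inv n (w : word n) : word n := rev (map (@letter_inv n) w).

Definition letter_map n N (e : 'I_n -> 'I_N) (x : letter n) : letter N :=
  (e x.1, x.2).

Lemma letter_code_lt n (x : letter n) : letter_code x < n.*2.
Proof.
case: x => i b; rewrite /letter_code /=.
by apply: (@leq_trans i.+1.*2); rewrite ?leq_double // doubleS; case: b;
  rewrite ?addn1 ?addn0.
Qed.

Lemma letter_code_inv n (x : letter n) :
  letter_code (letter_inv x) = digit_inv (letter_code x).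
Proof.
case: x => i b; rewrite /letter_code /digit_inv /= oddD odd_double oddb /=.
by case: b; rewrite /= ?addn1 ?addn0.
Qed.

Lemma code_beheadE n (w : word n) :
  code_behead n (word_code w) = word_code (behead w).
Proof.
case: w => [|x w]; rewrite /code_behead /=; first by rewrite div0n.
have ltx := letter_code_lt x; have n0 := leq_ltn_trans (leq0n _) ltx.
by rewrite addnC mulnC divnMDl // divn_small ?addn0.
Qed.

Lemma iter_code_behead n i (w : word n) :
  iter i (code_behead n) (word_code w) = word_code (drop i w).
Proof.
by elim: i w => [|i IHi] w; rewrite ?drop0 // iterSr code_beheadE IHi;
  case: w.
Qed.

(** Letter codes depend on the index and the sign only, not on the number of generators: a renaming
    [e] that keeps indices changes only the base of numeration. *)
Lemma code_cons_invE n N (e : 'I_n -> 'I_N) (x : letter n) (w : word n)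
    (t : word N) : (forall i, e i = i :> nat) ->
  code_cons_inv n N (word_code (x :: w)) (word_code t) =
  word_code (letter_map e (letter_inv x) :: t).
Proof.
move=> eE; rewrite /= addSn [letter_code x + _]addnC [_ * word_code w]mulnC.
rewrite /code_cons_inv modnMDl modn_small ?letter_code_lt //.
by rewrite -letter_code_inv /letter_code /= eE.
Qed.

Lemma size_word_code n (w : word n) : size w <= word_code w.
Proof.
elim: w => //= x w IHw; rewrite addSn ltnS; apply: leq_trans IHw _.
have n0 : 0 < n.*2 by exact: leq_ltn_trans (letter_code_lt x).
by rewrite (leq_trans _ (leq_addl _ _)) // leq_pmull.
Qed.

(** Letters are read from the front and each inverse is put in front of the result, so the order is
    reversed, as inversion requires. *)
Lemma code_cat_invE n N (e : 'I_n -> 'I_N) (w : word n) (t : word N) :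
  (forall i, e i = i :> nat) ->
  code_cat_inv n N (word_code w) (word_code t) =
  word_code (map (letter_map e) (word_inv w) ++ t).
Proof.
move=> eE; rewrite /code_cat_inv.
have H k : iteri k (fun i => code_cons_inv n N
    (iter i (code_behead n) (word_code w))) (word_code t) =
  word_code (map (letter_map e) (word_inv (take k w)) ++ t).
  elim: k => [|k IHk]; first by rewrite take0.
  rewrite [LHS]/= IHk iter_code_behead.
  (* Past the last letter the remaining code is [0], on which [code_cons_inv] returns its
     accumulator. *)
  case: (ltnP k (size w)) => [ltk | gek]; last first.
    by rewrite drop_oversize // !take_oversize // ltnW.
  case: w ltk {IHk} => // x0 w0; set w := _ :: _ => ltk.
  rewrite (drop_nth x0) // (code_cons_invE (e := e)) // (take_nth x0) //.
  by rewrite /word_inv map_rcons rev_rcons.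
by rewrite H take_oversize // size_word_code.
Qed.

Lemma letter_invK n : involutive (@letter_inv n).
Proof. by case=> i b; rewrite /letter_inv /= negbK. Qed.

Lemma word_invK n : involutive (@word_inv n).
Proof.
move=> w; rewrite /word_inv map_rev revK mapK //; exact: letter_invK.
Qed.

Lemma word_inv_map n N (e : 'I_n -> 'I_N) (w : word n) :
  word_inv (map (letter_map e) w) =
  map (letter_map e) (word_inv w).
Proof. by rewrite /word_inv map_rev -!map_comp. Qed.

Local Open Scope group_scope.

(** * Commutators in the wreath product *)

Lemma word_eval_cat (G : groupType) n (g : 'I_n -> G) u v :
  word_eval g (u ++ v) = word_eval g u * word_eval g v.
Proof. exact: big_cat. Qed.

Lemma word_eval1 (G : groupType) n (g : 'I_n -> G) x :
  word_eval g [:: x] = if x.2 then (g x.1)^-1 else g x.1.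
Proof. exact: big_seq1. Qed.

Lemma word_eval_inv (G : groupType) n (g : 'I_n -> G) w :
  word_eval g (word_inv w) = (word_eval g w)^-1.
Proof.
elim: w => [|x w IHw]; first by rewrite /word_eval !big_nil invg1.
rewrite /word_inv /= rev_cons -cats1 word_eval_cat -/(word_inv w) IHw.
rewrite -(cat1s x w) word_eval_cat invgM !word_eval1 /=.
by case: x.2; rewrite /= ?invgK.
Qed.

Section Wreath.
Context {A B : groupType} {m n : nat} (gA : 'I_m -> A) (gB : 'I_n -> B).
Context (H : set B).

Lemma wreath_gens_lshift (j : 'I_n) :
  wreath_gens gA gB H (lshift m j) = Wreath (gB j) base_one.
Proof. by rewrite /wreath_gens (unsplitK (inl j)). Qed.

Lemma wreath_gens_rshift (k : 'I_m) :
  wreath_gens gA gB H (rshift n k) =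
  Wreath 1 (base_single (gA k) (rcoset0 H)).
Proof. by rewrite /wreath_gens (unsplitK (inr k)). Qed.

Lemma word_eval_lshift (w : word n) :
  word_eval (wreath_gens gA gB H) (map (letter_map (lshift m)) w) =
  Wreath (word_eval gB w) base_one.
Proof.
elim: w => [|x w IHw] /=; first by rewrite /word_eval !big_nil.
rewrite -cat1s word_eval_cat IHw -(cat1s x w) word_eval_cat !word_eval1 /=.
rewrite wreath_gens_lshift; case: x.2; apply: wreath_ext => //= s;
  by rewrite !(base_mulE, base_actE, base_invE, base_oneE) ?invg1 mulg1.
Qed.

(** The stabilizer of [s_0] is [H]: if [Hb = H] then [b = 1 * b] lies in [H]; conversely
    [x = (x * b^-1) * b] for [x] in [H]. *)
Lemma rcoset_act0 (b : B) : group_closed [in H] ->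
  rcoset_act (rcoset0 H) b = rcoset0 H <-> H b.
Proof.
move=> Hgrp; have H1 : H 1 by apply: set_mem; case: Hgrp.
have HM x y : H x -> H y -> H (x * y).
  by move=> Hx Hy; apply: set_mem; apply: group_closedM => //; apply: mem_set.
have HV x : H x -> H x^-1.
  by move=> Hx; apply: set_mem; apply: group_closedV => //; apply: mem_set.
split=> [/(congr1 (@rcoset_set B H)) /= E | Hb].
  by rewrite -E; exists 1; last exact: mul1g.
apply: rcoset_ext; apply/seteqP; split=> [_ [x Hx <-] | x Hx]; first exact: HM.
by exists (x * b^-1); rewrite ?mulgVK //; apply: HM => //; apply: HV.
Qed.

Lemma commute_base_single (a : A) (b : B) : a <> 1 -> group_closed [in H] ->
  let x := Wreath b base_one : wreath A H in
  let y := Wreath 1 (base_single a (rcoset0 H)) : wreath A H in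
  x * y = y * x <-> H b.
Proof.
move=> a1 Hgrp x y; rewrite -(rcoset_act0 _ Hgrp).
have xyE s : wr_base (x * y) s = if s == rcoset0 H then a else 1.
  by rewrite base_mulE base_actE base_oneE mul1g base_singleE.
have yxE s : wr_base (y * x) s =
    if rcoset_act s b^-1 == rcoset0 H then a else 1.
  by rewrite base_mulE base_actE base_oneE mulg1 base_singleE.
split=> [E | E].
  (* At [s_0] the product [x * y] takes the value [a], which differs from [1], so [y * x] must also
     be supported there. *)
  have := yxE (rcoset0 H); rewrite -E xyE eqxx.
  by case: eqP => [E0 _ | _ /a1 []]; rewrite -{1}E0 rcoset_actKV.
apply: wreath_ext => [|s]; first by rewrite /= mulg1 mul1g.
rewrite xyE yxE -{1}E; congr (if _ then _ else _).
by apply/eqP/eqP => [-> | <-]; rewrite ?rcoset_actK ?rcoset_actKV.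
Qed.

End Wreath.

(** * Reduction of membership to conjugacy *)

Lemma conjugate1 (G : groupType) (x : G) : conjugate x 1 <-> x = 1.
Proof.
split=> [[z] | ->]; last by exists 1; rewrite conj1g.
by move/(canLR (conjgK z)); rewrite conj1g.
Qed.

Theorem corollary1p0p5 (A B : groupType)
    (m : nat) (gA : 'I_m -> A) (RA : set (word m))
    (n : nat) (gB : 'I_n -> B) (RB : set (word n))
    (HA : recursive_presentation gA RA)
    (HB : recursive_presentation gB RB)
    (A_nontrivial : exists a : A, a <> 1)
    (B_nontrivial : exists b : B, b <> 1)
    (H : set B) (H_subgroup : group_closed [in H]) :
  ~ membership_solvable gB H -> ~ conjugacy_solvable (wreath_gens gA gB H).
Proof.
move=> nmem [F [prF FP]]; apply: nmem.
(* If every generator were trivial, every word would evaluate to [1]. *)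
have [k gk1] : exists k, gA k <> 1.
  apply: contrapT => /forallNP gA1; have [a] := A_nontrivial; apply.
  have [[/(_ a)[w <-] _] _] := HA.
  apply: big1_seq => x _.
  by have /contrapT -> := gA1 x.1; case: x.2; rewrite ?invg1.
(* Without generators [B] would be trivial; positivity keeps the divisor [n.*2] nonzero. *)
have n0 : (0 < n)%N.
  have [b b1] := B_nontrivial; have [[/(_ b)[w Ew] _] _] := HB.
  case: w Ew => [Eb | [i _] _ _]; last exact: leq_ltn_trans (ltn_ord i).
  by case: b1; rewrite -Eb /word_eval big_nil.
pose N := (n + m)%N; pose y : letter N := (rshift n k, false).
have N0 : (0 < N)%N by rewrite ltn_addr.
pose up (w : word n) : word N := map (letter_map (lshift m)) w.
pose u w := word_inv (up w) ++ letter_inv y :: up w ++ [:: y].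
(* [w] is re-encoded over [N] generators by inverting it twice. *)
pose cw c := code_cat_inv N N (code_cat_inv n N c 0) (word_code [:: y]).
(* The inner sum is one numeration step that prepends [letter_inv y]; a third inversion then puts
   the inverse of [w] in front. *)
pose cu c := code_cat_inv n N c
  ((letter_code (letter_inv y)).+1 + N.*2 * cw c)%N.
have cuE w : cu (word_code w) = word_code (u w).
  have cwE : cw (word_code w) = word_code (up w ++ [:: y]).
    have lE (i : 'I_n) : lshift m i = i :> nat by [].
    rewrite /cw (code_cat_invE w [::] lE) cats0.
    rewrite (code_cat_invE (e := id)) // word_inv_map word_invK.
    by congr (word_code (_ ++ _)); rewrite -map_comp.
  rewrite /cu cwE -/(word_code (letter_inv y :: up w ++ [:: y])).
  by rewrite (code_cat_invE (e := lshift m)) // -word_inv_map.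
have rid : recursive1 id := recursive_nth 1 0 isT.
have rcw : recursive1 cw.
  apply: recursive1_code_cat_inv => //; last exact: (recursive_const 1).
  by apply: recursive1_code_cat_inv => //; exact: (recursive_const 1 0).
have rcu : recursive1 cu.
  apply: recursive1_code_cat_inv => //.
  apply: (recursive_app2 recursive2_addn (recursive_const 1 _)).
  exact: (recursive_app1 (recursive1_muln _) rcw).
(* The second component [0] is the code of the empty word. *)
pose G (i : 'I_2) (v : 1.-tuple nat) := if i == ord0 then cu (nth 0 v 0) else 0.
have rG i : recursive (G i).
  by rewrite /G; case: (i == ord0); [exact: rcu | exact: recursive_const].
exists (fun v z => exists w : 2.-tuple nat,
  (forall i, tnth w i = G i v) /\ F w z).
split=> [|ws]; first exact: (PR_comp prF rG).
set w := thead ws.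
(* The word [u w] evaluates to [(y x)^-1 (x y)], with [x] and [y] the values of [up w] and of the
   letter [y]; it is trivial exactly when they commute. *)
have uE : conjugate (word_eval (wreath_gens gA gB H) (u w))
    (word_eval (wreath_gens gA gB H) [::]) <-> H (word_eval gB w).
  rewrite {2}/word_eval big_nil conjugate1.
  rewrite -(commute_base_single _ gk1 H_subgroup) -(wreath_gens_rshift gA gB).
  rewrite -(word_eval_lshift gA) word_eval_cat word_eval_inv.
  rewrite -cat1s !word_eval_cat !word_eval1 /= mulgA -invgM.
  split=> [/(canRL (mulVKg _)) | ->]; last exact: mulVg.
  by rewrite mulg1.
have [F1 F0] := FP [tuple u w; [::]].
have uG i : tnth [tuple of map (@word_code N) [tuple u w; [::]]] i =
    G i [tuple of map (@word_code n) ws].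
  have -> : ws = [tuple w] by apply: eq_from_tnth => j; rewrite ord1.
  rewrite tnth_map /G (tnth_nth [::]) /= cuE.
  by case: i => -[|[|i]].
split=> Hw; exists [tuple of map (@word_code N) [tuple u w; [::]]];
  split=> //; [exact/F1/uE | by apply: F0 => /uE].
Qed.
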